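(* Let $n\ge2$, $\mathfrak{g}_0=\mathfrak{so}(2n,3)$, and let $V=V_{min}(\mathfrak{so}(2n,3))$ be the unique minimal $(\mathfrak{g},K)$-module. If $n$ is even, then the Dirac triples of $V$ are exactly $$(\mu_1,\rho_1^+,\lambda_{n+1}^-),\quad(\mu_1,\rho_1^-,\lambda_{n+1}^+),\quad(\mu_1,\rho_2^+,\lambda_{n+1}^+),\quad(\mu_1,\rho_2^-,\lambda_{n+1}^-).$$ If $n$ is odd, then the Dirac triples of $V$ are exactly $$(\mu_1,\rho_1^+,\lambda_{n+1}^+),\quad(\mu_1,\rho_1^-,\lambda_{n+1}^-),\quad(\mu_1,\rho_2^+,\lambda_{n+1}^-),\quad(\mu_1,\rho_2^-,\lambda_{n+1}^+).$$
   Context: Let $\mathfrak{g}=\mathfrak{so}(2n+3,\mathbb{C})$, $\mathfrak{k}=\mathfrak{so}(2n,\mathbb{C})\oplus\mathfrak{so}(3,\mathbb{C})$; $G$ is connected and simply connected with Lie algebra $\mathfrak{g}_0$ and $K$ the connected subgroup corresponding to $\mathfrak{k}$. Let $\mathfrak{h}=\mathfrak{t}$ be a Cartan subalgebra of $\mathfrak{k}$ and $\mathfrak{g}$, with standard coordinates $\mathfrak{h}^*=\mathbb{C}^{n+1}$. Simple roots: $\{e_i-e_{i+1}:1\le i\le n\}\cup\{e_{n+1}\}$ for $\mathfrak{g}$ and $\{e_i-e_{i+1}:1\le i\le n-1\}\cup\{e_{n-1}+e_n,e_{n+1}\}$ for $\mathfrak{k}$. Half sums of positive roots: $\rho_{\mathfrak{g}}=(n+\frac12,n-\frac12,\dots,\frac32,\frac12)$,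 $\rho_{\mathfrak{k}}=(n-1,n-2,\dots,1,0,\frac12)$. An element is $K$-dominant if it pairs nonnegatively with all positive roots of $\mathfrak{k}$. $V$ is the unique (known) irreducible $(\mathfrak{g},K)$-module whose annihilator is the Joseph ideal. It has infinitesimal character $\lambda_0=(n-\frac12,n-\frac32,\dots,\frac32,\frac12,1)$, and its $K$-types, each of multiplicity one, have highest weights $\mu_s=\mu_0+s\beta$, $s=0,1,2,\dots$, with $\mu_0=(0,\dots,0,n-\frac32)$, $\beta=(1,0,\dots,0,1)$. Let $R_K(\mathfrak{g})$ (resp. $\Lambda_K(V)$) be the set of $K$-dominant elements of $W(\mathfrak{g},\mathfrak{h})\rho_{\mathfrak{g}}$ (resp. $W(\mathfrak{g},\mathfrak{h})\lambda_0$), and for $v\in\mathfrak{t}^*$ let $\{v\}$ be the unique $K$-dominant element of $W(\mathfrak{k},\mathfrak{t})v$. A Dirac triple of $V$ is a triple $(\mu,\rho,\lambda)$ with $\rho\in R_K(\mathfrak{g})$, $\lambda\in\Lambda_K(V)$, $\mu$ the highest weight of a $K$-type of $V$, and $\{\mu-\rho+\rho_{\mathfrak{k}}\}=\lambda-\rho_{\mathfrak{k}}$. For $\epsilon\in\{\pm1\}$ (written $\pm$): $\rho_1^\epsilon=(n-\frac12,n-\frac32,\dots,\frac32,\frac{\epsilon}{2},n+\frac12)$; $\rho_2^\epsilon=(n+\frac12,n-\frac32,n-\frac52,\dots,\frac32,\frac{\epsilon}2,n-\frac12)$, i.e. the first $n-1$ coordinates are $n+\frac12,n-\frac12,\dots,\frac32$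 in decreasing order with $n-\frac12$ omitted, followed by $\frac{\epsilon}{2}$ and $n-\frac12$; $\lambda_{n+1}^\epsilon=(n-\frac12,n-\frac32,\dots,\frac32,\frac{\epsilon}{2},1)$. *)

(* Defs.v *)
From HB Require Import structures.
From mathcomp Require Import all_boot all_order all_algebra.
From mathcomp Require Import complex.
From mathcomp Require Import reals.

Set Implicit Arguments.
Unset Strict Implicit.
Unset Printing Implicit Defensive.

Import Order.TTheory GRing.Theory Num.Theory.

Local Open Scope ring_scope.
Local Open Scope complex_scope.

(** * Weights: h^* = C^(n+1), with its standard bilinear form *)

Section Weights.
Variables (R : realType) (n : nat).

Definition weight := 'rV[R[i]]_n.+1.

(* Coordinates are numbered from 0: [bvec i] is the paper's e_(i+1). *)
Definition bvec (i : 'I_n.+1) : weight := delta_mx 0 i.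

Definition pairing (u v : weight) : R[i] := \sum_(j < n.+1) u 0 j * v 0 j.

(* Positive roots of type B_(n+1), simple roots e_i - e_(i+1) and e_(n+1). *)
Inductive pos_root_g : weight -> Prop :=
| pos_root_g_sub (i j : 'I_n.+1) : (i < j)%N -> pos_root_g (bvec i - bvec j)
| pos_root_g_add (i j : 'I_n.+1) : (i < j)%N -> pos_root_g (bvec i + bvec j)
| pos_root_g_short (i : 'I_n.+1) : pos_root_g (bvec i).

(* Positive roots of type D_n x B_1: D_n lives on the first n coordinates
   (simple roots e_i - e_(i+1) and e_(n-1) + e_n), B_1 on the last one. *)
Inductive pos_root_k : weight -> Prop :=
| pos_root_k_sub (i j : 'I_n.+1) : (i < j < n)%N -> pos_root_k (bvec i - bvec j)
| pos_root_k_add (i j : 'I_n.+1) : (i < j < n)%N -> pos_root_k (bvec i + bvec j)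
| pos_root_k_short : pos_root_k (bvec ord_max).

Definition reflection (a v : weight) : weight :=
  v - (2 * pairing v a / pairing a a) *: a.

(* [weyl_orbit Phi v u]: u lies in the orbit of v under the group generated by
   the reflections in the elements of Phi. *)
Inductive weyl_orbit (Phi : weight -> Prop) (v : weight) : weight -> Prop :=
| weyl_orbit_refl : weyl_orbit Phi v v
| weyl_orbit_step (a u : weight) :
    Phi a -> weyl_orbit Phi v u -> weyl_orbit Phi v (reflection a u).

(* On R[i], [0 <= z] says that z is real and nonnegative. *)
Definition K_dominant (v : weight) : Prop :=
  forall a, pos_root_k a -> 0 <= pairing v a.

(* [K_dominant_rep v u]: {v} = u. A W(k,t)-orbit contains at most one dominant
   element. *)
Definition K_dominant_rep (v u : weight) : Prop :=
  weyl_orbit pos_root_k v u /\ K_dominant u.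

Definition rho_g : weight := \row_(j < n.+1) (n%:R + 2^-1 - j%:R).

Definition rho_k : weight :=
  \row_(j < n.+1) (if (j < n)%N then n%:R - 1 - j%:R else 2^-1).

Definition lambda0 : weight :=
  \row_(j < n.+1) (if (j < n)%N then n%:R - 2^-1 - j%:R else 1).

Definition mu0 : weight := (n%:R - 3 / 2) *: bvec ord_max.
Definition beta : weight := bvec ord0 + bvec ord_max.
Definition mu_ (s : nat) : weight := mu0 + s%:R *: beta.

Definition rho1 (eps : R[i]) : weight :=
  \row_(j < n.+1) (if (j < n.-1)%N then n%:R - 2^-1 - j%:R
                   else if j == n.-1 :> nat then eps / 2
                   else n%:R + 2^-1).

Definition rho2 (eps : R[i]) : weight :=
  \row_(j < n.+1) (if (j < n.-1)%N then
                     (if j == 0 :> nat then n%:R + 2^-1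
                      else n%:R - 2^-1 - j%:R)
                   else if j == n.-1 :> nat then eps / 2
                   else n%:R - 2^-1).

Definition lambda_last (eps : R[i]) : weight :=
  \row_(j < n.+1) (if (j < n.-1)%N then n%:R - 2^-1 - j%:R
                   else if j == n.-1 :> nat then eps / 2
                   else 1).

Definition R_K (v : weight) : Prop := weyl_orbit pos_root_g rho_g v /\ K_dominant v.

(* [Lambda_K l] is Lambda_K of any module with infinitesimal character l. *)
Definition Lambda_K (l v : weight) : Prop :=
  weyl_orbit pos_root_g l v /\ K_dominant v.

End Weights.

(** * The Lie algebras *)

Section LieAlgebras.
Variables (R : realType) (n : nat).

Definition mat := 'M[R[i]]_(2 * n + 3).

Definition lie (X Y : mat) : mat := X *m Y - Y *m X.

(* so(2n+3,C) as the skew-symmetric matrices, and so(2n,C) + so(3,C) as the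
   block-diagonal ones with blocks of sizes 2n and 3. *)
Definition in_g (X : mat) : Prop := X^T = - X.

Definition in_k (X : mat) : Prop :=
  in_g X /\ forall a b : 'I_(2 * n + 3), (a < 2 * n)%N != (b < 2 * n)%N -> X a b = 0.

(* [cartan j] is i (E_(2j,2j+1) - E_(2j+1,2j)). These span t, and a linear form
   on t is identified with the row of its values on them. *)
Definition cartan (j : 'I_n.+1) : mat :=
  \matrix_(a < 2 * n + 3, b < 2 * n + 3)
    ('i * (((a == (2 * j)%N :> nat) && (b == (2 * j).+1%N :> nat))%:R
         - ((a == (2 * j).+1%N :> nat) && (b == (2 * j)%N :> nat))%:R)).

Definition root_vector (a : weight R n) (X : mat) : Prop :=
  in_g X /\ forall j, lie (cartan j) X = a 0 j *: X.

(* Closure of the minimal nilpotent orbit, whose Jordan type is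
   (2,2,1,...,1). *)
Definition min_orbit_closure (X : mat) : Prop :=
  [/\ in_g X, X *m X = 0 & (\rank X <= 2)%N].

End LieAlgebras.

(** * g-modules and the enveloping algebra *)

(* [act X] is only meaningful for X in g. *)
Record gmodule (R : realType) (n : nat) := GModule {
  carrier :> lmodType R[i];
  act : mat R n -> carrier -> carrier;
  act_linear : forall X, in_g X -> forall (a : R[i]) (u v : carrier),
    act X (a *: u + v) = a *: act X u + act X v;
  act_linearl : forall X Y, in_g X -> in_g Y -> forall (a : R[i]) (v : carrier),
    act (a *: X + Y) v = a *: act X v + act Y v;
  act_lie : forall X Y, in_g X -> in_g Y -> forall v : carrier,
    act (lie X Y) v = act X (act Y v) - act Y (act X v)
}.

Section Modules.
Variables (R : realType) (n : nat).
Implicit Types (V M : gmodule R n).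

(* Elements of U(g) are represented by formal linear combinations of words
   X_1 ... X_d in elements of g. Since U(g) acts faithfully on itself, two of
   them agree in U(g) iff they act identically on every g-module. *)
Definition tensor := seq (R[i] * seq (mat R n)).

Definition in_T (p : tensor) : Prop :=
  forall cw, cw \in p -> forall X, X \in cw.2 -> in_g X.

Definition tensor_scale (c : R[i]) (p : tensor) : tensor :=
  [seq (c * cw.1, cw.2) | cw <- p].

Definition tensor_mul (p q : tensor) : tensor :=
  [seq (a.1 * b.1, a.2 ++ b.2) | a <- p, b <- q].

Definition tensor_act V (p : tensor) (v : V) : V :=
  \sum_(cw <- p) cw.1 *: foldr (@act R n V) v cw.2.

Definition eq_U (p q : tensor) : Prop :=
  forall M (v : M), tensor_act p v = tensor_act q v.

Definition central_U (p : tensor) : Prop :=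
  in_T p /\
  forall X, in_g X -> eq_U (tensor_mul p [:: (1, [:: X])])
                           (tensor_mul [:: (1, [:: X])] p).

Definition annihilator V (p : tensor) : Prop :=
  in_T p /\ forall v : V, tensor_act p v = 0.

Definition two_sided_ideal (I : tensor -> Prop) : Prop :=
  [/\ forall p, I p -> in_T p,
      forall p q, in_T p -> eq_U p q -> I q -> I p,
      I [::],
      forall p q c, I p -> I q -> I (tensor_scale c p ++ q)
    & forall p q, in_T p -> I q ->
        I (tensor_mul p q) /\ I (tensor_mul q p)].

Definition completely_prime (I : tensor -> Prop) : Prop :=
  ~ I [:: (1, [::])] /\
  forall p q, in_T p -> in_T q -> I (tensor_mul p q) -> I p \/ I q.

(* Degree d component of p in S(g), as a function on g, identified with g^* by
   the trace form. *)
Definition symbol (d : nat) (p : tensor) (Z : mat R n) : R[i] :=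
  \sum_(cw <- p | size cw.2 == d) cw.1 * \prod_(X <- cw.2) \tr (X *m Z).

(* Zero set of gr I in g. *)
Definition associated_variety (I : tensor -> Prop) (Z : mat R n) : Prop :=
  in_g Z /\
  forall d p, I p -> (forall cw, cw \in p -> (size cw.2 <= d)%N) ->
    symbol d p Z = 0.

(* The Joseph ideal is the unique completely prime two-sided ideal of U(g) whose
   associated variety is the closure of the minimal nilpotent orbit. *)
Definition joseph_ideal (I : tensor -> Prop) : Prop :=
  [/\ two_sided_ideal I, completely_prime I
    & forall Z, associated_variety I Z <-> min_orbit_closure Z].

Definition irreducible V : Prop :=
  (exists v : V, v != 0) /\
  forall P : V -> Prop,
    P 0 -> (forall (a : R[i]) u v, P u -> P v -> P (a *: u + v)) ->
    (forall X v, in_g X -> P v -> P (act X v)) ->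
    (forall v, P v -> v = 0) \/ (forall v, P v).

(* For n >= 2, G simply connected makes K = Spin(2n) x Spin(3) compact and
   simply connected, so a (g,K)-module is a g-module that is locally finite
   under k, and its K-types are its irreducible k-submodules. *)
Definition gK_module V : Prop :=
  forall v : V, exists (d : nat) (b : 'I_d -> V),
    (exists c : 'I_d -> R[i], v = \sum_l c l *: b l) /\
    forall X l, in_k X -> exists c : 'I_d -> R[i], act X (b l) = \sum_m c m *: b m.

Definition has_weight V (mu : weight R n) (v : V) : Prop :=
  forall j, act (cartan R j) v = mu 0 j *: v.

Definition K_highest_vector V (mu : weight R n) (v : V) : Prop :=
  [/\ v != 0, has_weight mu v
    & forall a X, pos_root_k a -> root_vector a X -> in_k X -> act X v = 0].

Definition g_highest_vector V (mu : weight R n) (v : V) : Prop :=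
  [/\ v != 0, has_weight mu v
    & forall a X, pos_root_g a -> root_vector a X -> act X v = 0].

Definition K_type V (mu : weight R n) : Prop :=
  exists v : V, K_highest_vector mu v.

Definition K_type_multiplicity_one V (mu : weight R n) : Prop :=
  K_type V mu /\
  forall u v : V, K_highest_vector mu u -> K_highest_vector mu v ->
    exists c : R[i], u = c *: v.

(* Harish-Chandra parametrization: the center of U(g) acts on V as on the
   modules of highest weight l - rho_g. *)
Definition infinitesimal_character V (l : weight R n) : Prop :=
  forall p, central_U p ->
  forall M (m : M), g_highest_vector (l - rho_g R n) m ->
  forall c : R[i], tensor_act p m = c *: m ->
  forall v : V, tensor_act p v = c *: v.

(* [l] is an infinitesimal character of V. *)
Definition dirac_triple V (l mu rho lam : weight R n) : Prop :=
  [/\ R_K rho, Lambda_K l lam, K_type V mu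
    & K_dominant_rep (mu - rho + rho_k R n) (lam - rho_k R n)].

End Modules.

(* Main.v *)
Require Import Defs.
From mathcomp Require Import all_boot all_order all_algebra all_fingroup.
From mathcomp Require Import complex.
From mathcomp Require Import reals.
From mathcomp Require Import zify ring lra.

(** Once the highest weights of the K-types are known, the classification of
    Dirac triples is a question about the coordinates of weights: for which s,
    rho and lambda is [mu_s - rho + rho_k] conjugate under W(k) to the dominant
    weight [lambda - rho_k]?

    Which [lambda] occur. The weight [lambda - rho_k] must be K-dominant, and
    since [rho_k] descends in unit steps on the first [n] coordinates, those of
    [lambda] must have absolute values at least 1 apart. Up to signs the
    coordinates of [lambda] are 1 and n-1/2, ..., 3/2, 1/2; the value 1 is
    within 1/2 of both 3/2 and 1/2, at least one of which is among the first
    [n], so 1 is the last coordinate and the gaps force the remaining ones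
    (lemma [Lambda_K_last_coord]). Hence [lambda = lambda_last d] with
    [d = 1] or [d = -1], and [lambda - rho_k = (1/2, ..., 1/2, d/2, 1/2)].

    Which [mu_s] and [rho] occur. The orbit of [lambda - rho_k] consists of
    weights all of whose coordinates are 1/2 or -1/2. Thus each coordinate of
    [rho] is known up to 1/2, and since the absolute values of these coordinates
    are n+1/2, ..., 1/2 in some order, the coordinates strictly between the
    first and the last are forced from right to left. The two largest values
    remain for the first and the last coordinates, and comparing their sum with
    that of [mu_s + rho_k] gives [s = 1]. So [rho] is [rho1 e] or [rho2 e]
    (lemma [rho_coord_cases]).

    Which signs match. The group W(k) permutes the first [n] coordinates and
    changes an even number of their signs, so it preserves their product;
    conversely two weights that differ by signs only and have the same nonzero
    product of first [n] coordinates are conjugate ([weyl_orbit_k_Dprod],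
    [weyl_orbit_k_sign]). Comparing these products gives [d = (-1)^(n+1) e] for
    [rho1 e] and [d = (-1)^n e] for [rho2 e]. *)

Set Implicit Arguments.
Unset Strict Implicit.
Unset Printing Implicit Defensive.

Import Order.TTheory GRing.Theory Num.Theory.

Local Open Scope ring_scope.
Local Open Scope complex_scope.

(** * Weyl group orbits in coordinates *)

Section Reflections.
Variables (R : realType) (n : nat).
Implicit Types (u v : weight R n) (i j k : 'I_n.+1).

Lemma pairing_bvec v i : pairing v (bvec R i) = v 0 i.
Proof.
rewrite /pairing (bigD1 i) //= big1 ?addr0 => [|j ji].
  by rewrite mxE !eqxx mulr1.
by rewrite mxE eqxx (negbTE ji) mulr0.
Qed.

Lemma pairingDr u v w : pairing u (v + w) = pairing u v + pairing u w.
Proof. by rewrite -big_split; apply: eq_bigr => j _; rewrite mxE mulrDr. Qed.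

Lemma pairingNr u v : pairing u (- v) = - pairing u v.
Proof. by rewrite -sumrN; apply: eq_bigr => j _; rewrite mxE mulrN. Qed.

Lemma reflection_sub i j v k : i != j ->
  reflection (bvec R i - bvec R j) v 0 k = v 0 (tperm i j k).
Proof.
move=> ij; rewrite /reflection !pairingDr !pairingNr !pairing_bvec !mxE.
rewrite !eqxx (eq_sym j i) (negbTE ij) /= subr0 sub0r opprK.
have -> : (2 * (v 0 i - v 0 j) / (1 + 1) : R[i]) = v 0 i - v 0 j by field.
case: tpermP => [->|->|/eqP/negbTE-> /eqP/negbTE->].
- by rewrite eqxx (negbTE ij) /=; ring.
- by rewrite eqxx (eq_sym j i) (negbTE ij) /=; ring.
- by rewrite /=; ring.
Qed.

Lemma reflection_add i j v k : i != j ->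
  reflection (bvec R i + bvec R j) v 0 k =
  (if (k == i) || (k == j) then - v 0 (tperm i j k) else v 0 k).
Proof.
move=> ij; rewrite /reflection !pairingDr !pairing_bvec !mxE.
rewrite !eqxx (eq_sym j i) (negbTE ij) /= addr0 add0r.
have -> : (2 * (v 0 i + v 0 j) / (1 + 1) : R[i]) = v 0 i + v 0 j by field.
case: tpermP => [->|->|/eqP/negbTE-> /eqP/negbTE->].
- by rewrite eqxx (negbTE ij) /=; ring.
- by rewrite eqxx (eq_sym j i) (negbTE ij) /=; ring.
- by rewrite /=; ring.
Qed.

Lemma reflection_short i v k :
  reflection (bvec R i) v 0 k = if k == i then - v 0 k else v 0 k.
Proof.
rewrite /reflection !pairing_bvec !mxE !eqxx /= divr1.
by case: eqP => [->|_] /=; ring.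
Qed.

Lemma weyl_orbit_trans (Phi : weight R n -> Prop) v u w :
  weyl_orbit Phi v u -> weyl_orbit Phi u w -> weyl_orbit Phi v w.
Proof. by move=> vu; elim=> // a x Pa _ IH; apply: weyl_orbit_step. Qed.

Lemma weyl_orbit_g_sq v u : weyl_orbit (@pos_root_g R n) v u ->
  exists s : 'S_n.+1, forall k, u 0 k ^+ 2 = v 0 (s k) ^+ 2.
Proof.
elim=> [|a {}u ra _ [s us]]; first by exists 1%g => k; rewrite perm1.
have ijP i j : (i < j)%N -> i != j by move=> ij; rewrite neq_ltn ij.
case: ra => [i j ij|i j ij|i].
- exists (tperm i j * s)%g => k.
  by rewrite reflection_sub ?ijP// us permM.
- exists (tperm i j * s)%g => k.
  rewrite reflection_add ?ijP// permM -us; case: ifP => [_|kij].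
    by rewrite sqrrN.
  move/norP: (negbT kij) => [ki kj].
  by rewrite tpermD // eq_sym.
- exists s => k; rewrite reflection_short -us; case: ifP => // _.
  by rewrite sqrrN.
Qed.

Lemma weyl_orbit_g_tperm v i j :
  weyl_orbit (@pos_root_g R n) v (\row_k v 0 (tperm i j k)).
Proof.
wlog ij : i j / (i < j)%N => [hw|].
  have [/hw//|/hw|/ord_inj->] := ltngtP i j.
    by rewrite tpermC.
  suff -> : \row_k v 0 (tperm j j k) = v by apply: weyl_orbit_refl.
  by apply/rowP => k; rewrite mxE tperm1 perm1.
have -> : \row_k v 0 (tperm i j k) = reflection (bvec R i - bvec R j) v.
  by apply/rowP => k; rewrite mxE reflection_sub // neq_ltn ij.
by apply: weyl_orbit_step; [apply: pos_root_g_sub|apply: weyl_orbit_refl].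
Qed.

Lemma weyl_orbit_g_perm v (s : 'S_n.+1) :
  weyl_orbit (@pos_root_g R n) v (\row_k v 0 (s k)).
Proof.
have [ts -> _] := prod_tpermP s.
elim: ts => [|t ts IH].
  rewrite big_nil; suff -> : \row_k v 0 ((1 : 'S_n.+1)%g k) = v by apply: weyl_orbit_refl.
  by apply/rowP => k; rewrite mxE perm1.
apply: (weyl_orbit_trans IH).
set w := \row_k _.
suff <- : \row_k w 0 (tperm t.1 t.2 k) = \row_k v 0 ((\prod_(i <- t :: ts) tperm i.1 i.2)%g k).
  exact: weyl_orbit_g_tperm.
by apply/rowP => k; rewrite !mxE big_cons permM.
Qed.

Lemma weyl_orbit_g_sign v u : (forall k, u 0 k ^+ 2 = v 0 k ^+ 2) ->
  weyl_orbit (@pos_root_g R n) v u.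
Proof.
have [m] := ubnP #|[set k | u 0 k != v 0 k]|.
elim: m v => // m IH v; rewrite ltnS => card_m uv.
have [D0|[k]] := set_0Vmem [set k | u 0 k != v 0 k].
  suff -> : u = v by apply: weyl_orbit_refl.
  by apply/rowP => k; move/setP/(_ k): D0; rewrite !inE => /negbFE/eqP.
rewrite inE => ukv; have uNv : u 0 k = - v 0 k.
  by move/eqP: (uv k); rewrite eqf_sqr (negbTE ukv) => /eqP.
set w := reflection (bvec R k) v.
apply: (@weyl_orbit_trans _ _ w).
  by apply: weyl_orbit_step; [apply: pos_root_g_short|apply: weyl_orbit_refl].
apply: IH => [|j]; last first.
  by rewrite uv reflection_short; case: ifP; rewrite ?sqrrN.
apply: leq_trans card_m; apply/proper_card/properP; split.
  apply/subsetP => j; rewrite !inE reflection_short.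
  by have [->|//] := eqVneq j k; rewrite ukv.
by exists k; rewrite !inE ?ukv // reflection_short eqxx uNv eqxx.
Qed.

(** W(g) is the group of all signed permutations of the coordinates, and signs
    are invisible exactly on squares. *)
Lemma weyl_orbit_gP v u : weyl_orbit (@pos_root_g R n) v u <->
  exists s : 'S_n.+1, forall k, u 0 k ^+ 2 = v 0 (s k) ^+ 2.
Proof.
split=> [|[s us]]; first exact: weyl_orbit_g_sq.
apply: (weyl_orbit_trans (weyl_orbit_g_perm v s)).
by apply: weyl_orbit_g_sign => k; rewrite us mxE.
Qed.

(** The Pfaffian-type invariant of the D_n factor, which separates D_n-orbits
    from B_n-orbits. *)
Definition Dprod v : R[i] := \prod_(k < n.+1 | (k < n)%N) v 0 k.

Lemma pos_root_kg a : @pos_root_k R n a -> pos_root_g a.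
Proof.
case=> [i j /andP[ij _]|i j /andP[ij _]|].
- exact: pos_root_g_sub.
- exact: pos_root_g_add.
- exact: pos_root_g_short.
Qed.

Lemma weyl_orbit_kg v u :
  weyl_orbit (@pos_root_k R n) v u -> weyl_orbit (@pos_root_g R n) v u.
Proof.
elim=> [|a w /pos_root_kg ra _ IH]; first exact: weyl_orbit_refl.
exact: weyl_orbit_step.
Qed.

Lemma Dprod_tperm v i j : (i < n)%N -> (j < n)%N ->
  \prod_(k < n.+1 | (k < n)%N) v 0 (tperm i j k) = Dprod v.
Proof.
move=> lin ljn; rewrite /Dprod [RHS](reindex_inj (@perm_inj _ (tperm i j))) /=.
by apply: eq_bigl => k; case: tpermP => [->|->|//]; rewrite lin ljn.
Qed.

(** The reflection in e_i + e_j swaps two coordinates and negates both, so the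
    two signs cancel in the product. *)
Lemma weyl_orbit_k_Dprod v u :
  weyl_orbit (@pos_root_k R n) v u -> Dprod u = Dprod v.
Proof.
elim=> // a {}u ra _ <-.
case: ra => [i j /andP[ij jn]|i j /andP[ij jn]|].
- rewrite -(Dprod_tperm u (ltn_trans ij jn) jn).
  by apply: eq_bigr => k _; rewrite reflection_sub // neq_ltn ij.
- have ij' : i != j by rewrite neq_ltn ij.
  rewrite -(Dprod_tperm u (ltn_trans ij jn) jn) /Dprod.
  rewrite [LHS](bigD1 i) ?(ltn_trans ij jn) //= [RHS](bigD1 i) ?(ltn_trans ij jn) //=.
  rewrite [X in _ * X = _](bigD1 j) ?jn 1?eq_sym //= [X in _ = _ * X](bigD1 j) ?jn 1?eq_sym //=.
  rewrite !reflection_add // !eqxx orbT /= !mulrA mulrNN; congr (_ * _).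
  apply: eq_bigr => k /andP[/andP[_ ki] kj].
  by rewrite reflection_add // (negbTE ki) (negbTE kj) tpermD // eq_sym.
- apply: eq_bigr => k kn; rewrite reflection_short; case: eqP => // kE.
  by move: kn; rewrite kE ltnn.
Qed.

(** The reflections in e_i - e_j and e_i + e_j commute and their product negates
    the coordinates i and j. *)
Lemma weyl_orbit_k_flip2 v i j : (i < n)%N -> (j < n)%N -> i != j ->
  weyl_orbit (@pos_root_k R n) v
    (\row_k if (k == i) || (k == j) then - v 0 k else v 0 k).
Proof.
wlog ij : i j / (i < j)%N => [hw lin ljn ij|lin ljn ijn].
  have [lij|lji|/ord_inj eij] := ltngtP i j; first exact: hw.
    rewrite (_ : \row__ _ = \row_k if (k == j) || (k == i) then - v 0 k else v 0 k).
      by apply: hw; rewrite // eq_sym.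
    by apply/rowP => k; rewrite !mxE orbC.
  by rewrite eij eqxx in ij.
set w := \row__ _.
have -> : w = reflection (bvec R i + bvec R j) (reflection (bvec R i - bvec R j) v).
  apply/rowP => k; rewrite mxE reflection_add // !reflection_sub // tpermK.
  by case: ifP => // /negbT/norP[ki kj]; rewrite tpermD // eq_sym.
apply: weyl_orbit_step; first by apply: pos_root_k_add; rewrite ij.
apply: weyl_orbit_step; first by apply: pos_root_k_sub; rewrite ij.
exact: weyl_orbit_refl.
Qed.

(** If u and v differ at one of the first n coordinates, equality of the nonzero
    products forces a second difference; negating both coordinates of v brings
    it closer to u. The last coordinate is handled by the reflection in the
    short root of the B_1 factor. *)
Lemma weyl_orbit_k_sign v u : (forall k, u 0 k ^+ 2 = v 0 k ^+ 2) ->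
  Dprod u = Dprod v -> Dprod v != 0 -> weyl_orbit (@pos_root_k R n) v u.
Proof.
pose D v := [set k : 'I_n.+1 | (k < n)%N && (u 0 k != v 0 k)].
have [m] := ubnP #|D v|.
elim: m v => // m IH v; rewrite ltnS => card_m uv uvD v_neq0.
have uN k : u 0 k != v 0 k -> u 0 k = - v 0 k.
  by move=> /negbTE ne; move/eqP: (uv k); rewrite eqf_sqr ne => /eqP.
have [D0|[i ]] := set_0Vmem (D v).
  have uvn k : (k < n)%N -> u 0 k = v 0 k.
    by move=> kn; move/setP/(_ k): D0; rewrite !inE kn => /negbFE/eqP.
  have kmax k : ~~ (k < n)%N -> k = ord_max.
    by rewrite -leqNgt => nk; apply/val_inj/eqP; rewrite eqn_leq nk -ltnS ltn_ord.
  have [uvm|/uN uNv] := eqVneq (u 0 ord_max) (v 0 ord_max).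
    suff -> : u = v by apply: weyl_orbit_refl.
    by apply/rowP => k; case: (boolP (k < n)%N) => [/uvn//|/kmax->].
  suff -> : u = reflection (bvec R ord_max) v.
    by apply: weyl_orbit_step; [apply: pos_root_k_short|apply: weyl_orbit_refl].
  apply/rowP => k; rewrite reflection_short.
  case: (boolP (k < n)%N) => [kn|/kmax->]; last by rewrite eqxx.
  by rewrite uvn //; case: eqP => // kE; rewrite kE ltnn in kn.
rewrite inE => /andP[lin ui].
have [j /and3P[ljn ij uj]] : exists j : 'I_n.+1,
    [&& (j < n)%N, i != j & u 0 j != v 0 j].
  apply/existsP; apply: contraNT ui => /existsPn noj.
  move: uvD v_neq0; rewrite /Dprod (bigD1 i) // [X in _ = X](bigD1 i) //=.
  rewrite [X in _ * X = _](eq_bigr (v 0)) => [|j /andP[jn ji]]; last first.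
    by move: (noj j); rewrite jn eq_sym ji => /negbNE/eqP.
  rewrite [X in X != 0](bigD1 i) //= mulf_eq0 negb_or => + /andP[_ p0].
  by move/(mulIf p0)->.
apply: (weyl_orbit_trans (weyl_orbit_k_flip2 v lin ljn ij)).
set w := \row__ _.
have wD : Dprod w = Dprod v.
  exact/weyl_orbit_k_Dprod/weyl_orbit_k_flip2.
apply: IH; rewrite ?wD //; last first.
  by move=> k; rewrite uv mxE; case: ifP; rewrite ?sqrrN.
apply: leq_trans card_m; apply/proper_card/properP; split.
  apply/subsetP => k; rewrite !inE mxE; case: ifP => // /orP[] /eqP->.
    by rewrite ui lin.
  by rewrite uj ljn.
by exists i; rewrite !inE ?lin ?ui // mxE eqxx (uN _ ui) eqxx.
Qed.

End Reflections.
(** * Real weights *)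

Section RealWeights.
Variables (R : realType) (n : nat).
Implicit Types (x y : 'I_n.+1 -> R) (i j k : 'I_n.+1).

(** All weights of the problem are real; moving them to R makes linear
    arithmetic over an ordered field available. *)
Definition real_weight x : weight R n := \row_j (x j)%:C.

(** A complex number whose square is that of a real number is real. *)
Lemma real_weightP x (u : weight R n) : (forall k, u 0 k ^+ 2 = (x k ^+ 2)%:C) ->
  exists2 y, u = real_weight y & forall k, y k ^+ 2 = x k ^+ 2.
Proof.
move=> ux; exists (fun k => complex.Re (u 0 k)) => [|k].
  apply/rowP => k; rewrite mxE; move/eqP: (ux k).
  by rewrite rmorphXn eqf_sqr -rmorphN => /orP[] /eqP ->.
move/eqP: (ux k); rewrite rmorphXn eqf_sqr -rmorphN => /orP[] /eqP -> //=.
by rewrite sqrrN.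
Qed.

Lemma real_weight_orbitP x (u : weight R n) :
  weyl_orbit (@pos_root_g R n) (real_weight x) u <->
  exists y, u = real_weight y /\
    exists s : 'S_n.+1, forall k, y k ^+ 2 = x (s k) ^+ 2.
Proof.
split=> [/weyl_orbit_gP[s us]|[y [-> [s ys]]]].
  have [|y -> yx] := @real_weightP (fun k => x (s k)) u.
    by move=> k; rewrite us mxE rmorphXn.
  by exists y; split=> //; exists s.
by apply/weyl_orbit_gP; exists s => k; rewrite !mxE -!rmorphXn ys.
Qed.

(** For i < j < n the roots e_i - e_j and e_i + e_j together bound |x_j| by
    x_i. *)
Lemma K_dominant_realP x : K_dominant (real_weight x) <->
  (forall i j, (i < j < n)%N -> `|x j| <= x i) /\ 0 <= x ord_max.
Proof.
split=> [dom|[dom max0] a].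
  split=> [i j ij|].
    have := dom _ (pos_root_k_sub R ij); have := dom _ (pos_root_k_add R ij).
    rewrite !pairingDr pairingNr !pairing_bvec !mxE -rmorphD -rmorphB !ler0c.
    by move=> ? ?; rewrite ler_norml; lra.
  by have := dom _ (pos_root_k_short R n); rewrite pairing_bvec mxE ler0c.
case=> [i j ij|i j ij|].
- rewrite pairingDr pairingNr !pairing_bvec !mxE -rmorphB ler0c.
  by have := dom _ _ ij; rewrite ler_norml; lra.
- rewrite pairingDr !pairing_bvec !mxE -rmorphD ler0c.
  by have := dom _ _ ij; rewrite ler_norml; lra.
- by rewrite pairing_bvec mxE ler0c.
Qed.

Lemma real_weightD x y :
  real_weight x + real_weight y = real_weight (fun k => x k + y k).
Proof. by apply/rowP => k; rewrite !mxE rmorphD. Qed.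

Lemma real_weightB x y :
  real_weight x - real_weight y = real_weight (fun k => x k - y k).
Proof. by apply/rowP => k; rewrite !mxE rmorphB. Qed.

Lemma Dprod_real_weight x :
  Dprod (real_weight x) = (\prod_(k < n.+1 | (k < n)%N) x k)%:C.
Proof. by rewrite rmorph_prod; apply: eq_bigr => k _; rewrite mxE. Qed.

Lemma eq_real_weight x y : x =1 y -> real_weight x = real_weight y.
Proof. by move=> xy; apply/rowP => k; rewrite !mxE xy. Qed.

Definition rho_g_coord k : R := n%:R + 2^-1 - k%:R.

Definition rho_k_coord k : R := if (k < n)%N then n%:R - 1 - k%:R else 2^-1.

Definition lambda0_coord k : R := if (k < n)%N then n%:R - 2^-1 - k%:R else 1.

Definition mu_coord (t : nat) k : R :=
  if k == 0 :> nat then t%:R else if (k < n)%N then 0 else n%:R - 3 / 2 + t%:R.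

Definition rho1_coord (e : R) k : R :=
  if (k < n.-1)%N then n%:R - 2^-1 - k%:R
  else if k == n.-1 :> nat then e / 2 else n%:R + 2^-1.

Definition rho2_coord (e : R) k : R :=
  if (k < n.-1)%N then
    (if k == 0 :> nat then n%:R + 2^-1 else n%:R - 2^-1 - k%:R)
  else if k == n.-1 :> nat then e / 2 else n%:R - 2^-1.

Definition lambda_last_coord (e : R) k : R :=
  if (k < n.-1)%N then n%:R - 2^-1 - k%:R
  else if k == n.-1 :> nat then e / 2 else 1.

Let morphE := (rmorph_nat, rmorph1, rmorph0, rmorphB, rmorphD, rmorphM, fmorphV).

Lemma rho_gE : rho_g R n = real_weight rho_g_coord.
Proof. by apply/rowP => k; rewrite !mxE !morphE. Qed.

Lemma rho_kE : rho_k R n = real_weight rho_k_coord.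
Proof. by apply/rowP => k; rewrite !mxE (fun_if (real_complex R)) !morphE. Qed.

Lemma lambda0E : lambda0 R n = real_weight lambda0_coord.
Proof. by apply/rowP => k; rewrite !mxE (fun_if (real_complex R)) !morphE. Qed.

Lemma rho1E e : rho1 n e%:C = real_weight (rho1_coord e).
Proof. by apply/rowP => k; rewrite !mxE !(fun_if (real_complex R)) !morphE. Qed.

Lemma rho2E e : rho2 n e%:C = real_weight (rho2_coord e).
Proof. by apply/rowP => k; rewrite !mxE !(fun_if (real_complex R)) !morphE. Qed.

Lemma lambda_lastE e : lambda_last n e%:C = real_weight (lambda_last_coord e).
Proof. by apply/rowP => k; rewrite !mxE !(fun_if (real_complex R)) !morphE. Qed.

Lemma ord_neq_max k : (k != ord_max) = (k < n)%N.
Proof. by rewrite -val_eqE /= ltn_neqAle -ltnS ltn_ord andbT. Qed.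

Lemma mu_E t : (0 < n)%N -> mu_ R n t = real_weight (mu_coord t).
Proof.
move=> n_gt0; apply/rowP => k; rewrite !mxE !eqxx /= /mu_coord -ord_neq_max.
rewrite !(fun_if (real_complex R)) !morphE -[k == ord0]val_eqE /=.
have [k0|_] := eqVneq (k : nat) 0%N; last first.
  by case: eqP => _; rewrite /= ?mulr1 ?add0r ?mulr0 ?addr0 ?mulr1 ?mulr0.
have /negbTE-> : k != ord_max by rewrite ord_neq_max k0.
by rewrite /= mulr0 add0r addr0 mulr1.
Qed.

End RealWeights.

(** * Determination of lambda *)

Section Triples.
Variables (R : realType) (n : nat).
Hypothesis n_ge2 : (2 <= n)%N.
Implicit Types (i j k : 'I_n.+1) (e d : R).

Local Notation realw := (@real_weight R n).

Lemma natr_pred m : (0 < m)%N -> m.-1%:R = m%:R - 1 :> R.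
Proof. by case: m => // m _; rewrite -natr1 addrK. Qed.

Lemma ord_cases k :
  [\/ (k < n.-1)%N, k = n.-1 :> nat | k = n :> nat].
Proof.
have k_lt := ltn_ord k; have [kn|kn|kn] := ltngtP k n.-1.
- exact: Or31.
- by apply: Or33; lia.
- exact: Or32.
Qed.

(** The coordinates of lambda_last e - rho_k. *)
Definition half_coord e k : R := if k == n.-1 :> nat then e / 2 else 2^-1.

Lemma lambda_last_sub_rho_k e :
  lambda_last n e%:C - rho_k R n = realw (half_coord e).
Proof.
rewrite lambda_lastE rho_kE real_weightB; apply: eq_real_weight => k.
rewrite /lambda_last_coord /rho_k_coord /half_coord.
case: (ord_cases k) => kE.
- by rewrite kE ltn_eqF // (_ : (k < n)%N) ?(_ : (k == n.-1 :> nat) = false); [lra|lia..].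
- rewrite kE ltnn eqxx (_ : (n.-1 < n)%N); last lia.
  by rewrite natr_pred; [lra|lia].
- rewrite kE ltnn (_ : (n < n.-1)%N = false); last lia.
  by rewrite (_ : (n == n.-1) = false); [lra|lia].
Qed.

Lemma K_dominant_half e : `|e| <= 1 -> K_dominant (realw (half_coord e)).
Proof.
rewrite ler_norml => e1; apply/K_dominant_realP; split=> [i j ij|]; last first.
  by rewrite /half_coord /= (_ : (n == n.-1) = false); [lra|lia].
rewrite /half_coord (_ : (i == n.-1 :> nat) = false); last lia.
by case: ifP => _; rewrite ler_norml; lra.
Qed.

(** K-dominance of lambda - rho_k separates the absolute values of the first n
    coordinates of lambda by at least 1 ([gap], [far]). The value 1 is too close
    to both 1/2 and 3/2 to share these coordinates with either, so it comes
    last. The other absolute values lie between 1/2 and n - 1/2, an interval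
    with just enough room for n values with such gaps. *)
Lemma Lambda_K_last_coord lam : Lambda_K (lambda0 R n) lam ->
  K_dominant (lam - rho_k R n) ->
  exists2 e : R, e = 1 \/ e = -1 & lam = lambda_last n e%:C.
Proof.
rewrite lambda0E => -[/real_weight_orbitP[a [-> [s asq]]]].
rewrite rho_kE real_weightB => /K_dominant_realP[_ a_last] /K_dominant_realP[adom _].
have aE k : `|a k| = lambda0_coord R (s k).
  have l0 : 0 <= lambda0_coord R (s k).
    rewrite /lambda0_coord; case: ifP => // skn.
    by have := ler_nat R (s k).+1 n; rewrite skn -natr1; lra.
  by have /eqP := asq k; rewrite eqf_sqr => /orP[]/eqP->; rewrite ?normrN ger0_norm.
have gap i j : (i < j < n)%N -> `|a j| + (j%:R - i%:R) <= a i.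
  move=> ij; have := adom i j ij; rewrite /rho_k_coord.
  have lin : (i < n)%N by lia.
  have ljn : (j < n)%N by lia.
  rewrite lin ljn.
  have : j.+1%:R <= n%:R :> R by rewrite ler_nat; lia.
  rewrite -natr1 !ler_norml; by case: (ger0P (a j)); lra.
have far i j : (i < n)%N -> (j < n)%N -> i != j -> 1 <= `| `|a i| - `|a j| |.
  wlog ij : i j / (i < j)%N => [hw lin ljn|lin ljn _].
    rewrite neq_ltn => /orP[] ij; first by apply: hw => //; rewrite neq_ltn ij.
    by rewrite distrC; apply: hw => //; rewrite neq_ltn ij.
  have := gap i j; rewrite ij ljn => /(_ isT).
  have : i.+1%:R <= j%:R :> R by rewrite ler_nat.
  rewrite -natr1; have := ler_norm (a i) => ? ? ?.
  by apply: le_trans (ler_norm _); lra.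
have s_last : s ord_max = ord_max.
  apply/eqP; apply: contraT => s_max.
  pose p := (s^-1)%g ord_max.
  have pn : (p < n)%N.
    rewrite -ord_neq_max; apply: contraNneq s_max => pE.
    by rewrite -{1}pE permKV.
  have ap : `|a p| = 1 by rewrite aE permKV /lambda0_coord /= ltnn.
  (* The indices m = n-1 and m = n-2 of lambda0 carry the values 1/2 and 3/2. As
     1 is at the position p < n, each of them would have to be at position n. *)
  have near m : (m.+1 = n \/ m.+2 = n)%N -> s ord_max = m :> nat.
    move=> mn; have m_lt : (m < n.+1)%N by lia.
    pose q := (s^-1)%g (Ordinal m_lt).
    have [qn|] := boolP (q < n)%N; last first.
      rewrite -ord_neq_max negbK => /eqP qE.
      by rewrite -qE permKV.
    have pq : p != q.
      by apply/negP => /eqP/perm_inj/(congr1 val) /=; lia.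
    have := far _ _ pn qn pq; rewrite ap aE permKV /lambda0_coord /=.
    rewrite (_ : (m < n)%N); last lia.
    have nE : n%:R = m%:R + 1 :> R \/ n%:R = m%:R + 2 :> R.
      case: mn => <-; [left|right]; rewrite -!natr1; lra.
    by rewrite ler_normr; case: nE => -> /orP[] ?; exfalso; lra.
  have := near n.-1; have := near n.-2.
  by move=> h1 h2; have := h1 ltac:(lia); rewrite h2; lia.
have a_max : a ord_max = 1.
  by rewrite -[LHS]ger0_norm // aE s_last /lambda0_coord /= ltnn.
have s_lt k : (k < n)%N -> (s k < n)%N.
  rewrite -!ord_neq_max; apply: contraNneq => skE.
  by apply/eqP/(@perm_inj _ s); rewrite skE s_last.
have abs_a k : (k < n)%N -> `|a k| = n%:R - 2^-1 - k%:R.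
  move=> kn; apply/eqP; rewrite eq_le.
  have up : `|a k| <= n%:R - 2^-1 - k%:R.
    have [k0|k0] := eqVneq k ord0.
      rewrite k0 aE /lambda0_coord s_lt /=; last lia.
      by have := ler0n R (s ord0); lra.
    have k_gt0 : (0 < k)%N by rewrite lt0n.
    have := gap ord0 k; rewrite /= k_gt0 kn => /(_ isT).
    have := ler_norm (a ord0); rewrite [`|a ord0|]aE /lambda0_coord s_lt /=; last lia.
    by have := ler0n R (s ord0); lra.
  rewrite up /=.
  have pred_lt : (n.-1 < n.+1)%N by lia.
  have low : 2^-1 <= `|a (Ordinal pred_lt)|.
    rewrite aE /lambda0_coord s_lt /=; last lia.
    have : (s (Ordinal pred_lt)).+1%:R <= n%:R :> R by rewrite ler_nat s_lt //=; lia.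
    by rewrite -natr1; lra.
  have [kE|kE] := eqVneq (k : nat) n.-1.
    have -> : k = Ordinal pred_lt by apply: val_inj.
    by rewrite /= natr_pred; [lra|lia].
  have := gap k (Ordinal pred_lt); rewrite (_ : (_ < _ < _)%N = true); last by rewrite /=; lia.
  move=> /(_ isT) /=; rewrite natr_pred; last lia.
  by have := ler_norm (a k); lra.
have pred_lt : (n.-1 < n.+1)%N by lia.
(* The coordinate with index n-1 is e/2, and only its absolute value is forced. *)
exists (2 * a (Ordinal pred_lt)).
  have := abs_a (Ordinal pred_lt); rewrite /= natr_pred; last lia.
  move=> /(_ ltac:(lia)); case: ler0P => _ ?; [right|left]; lra.
rewrite lambda_lastE; apply: eq_real_weight => k; rewrite /lambda_last_coord.
case: (ord_cases k) => kE.
- rewrite kE -abs_a ?ger0_norm //; last lia.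
  have := gap k (Ordinal pred_lt); rewrite (_ : (_ < _ < _)%N = true); last by rewrite /=; lia.
  move=> /(_ isT) /=; have : k%:R <= n.-1%:R :> R by rewrite ler_nat ltnW.
  by rewrite natr_pred; [have := normr_ge0 (a (Ordinal pred_lt)); lra|lia].
- rewrite kE ltnn eqxx (_ : k = Ordinal pred_lt); first lra.
  exact: val_inj.
- rewrite (_ : k = ord_max); last exact: val_inj.
  rewrite /= (_ : (n < n.-1)%N = false); last lia.
  by rewrite (_ : (n == n.-1) = false) //; lia.
Qed.

(** * Determination of mu and rho *)

(** Let s send the position k to the index such that |r_k| = n + 1/2 - s(k). A
    coordinate k with 0 < k < n leaves the two possibilities s(k) = k + 1 and
    s(k) = k + 2; at k = n - 1 only the first is in range, and injectivity of s
    propagates it downwards. Hence s maps the two end positions to 0 and 1, and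
    the sum of the two end coordinates of r determines t. *)
Lemma rho_coord_cases (t : nat) (r : 'I_n.+1 -> R) (s : 'S_n.+1) :
  (forall k, r k ^+ 2 = rho_g_coord R (s k) ^+ 2) ->
  (forall k, (mu_coord R t k - r k + rho_k_coord R k) ^+ 2 = 2^-1 ^+ 2) ->
  t = 1%N /\ exists2 e : R, e = 1 \/ e = -1 & r =1 rho1_coord e \/ r =1 rho2_coord e.
Proof.
move=> rsq half.
have rE k : r k = rho_g_coord R (s k) \/ r k = - rho_g_coord R (s k).
  by move/eqP: (rsq k); rewrite eqf_sqr => /orP[] /eqP; [left|right].
have stepE k : r k = mu_coord R t k + rho_k_coord R k - 2^-1 \/
               r k = mu_coord R t k + rho_k_coord R k + 2^-1.
  by move/eqP: (half k); rewrite eqf_sqr => /orP[] /eqP ?; [left|right]; lra.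
have s_le k : (s k)%:R <= n%:R :> R by rewrite ler_nat -ltnS.
have n2 : 2 <= n%:R :> R by rewrite (ler_nat R 2).
(* The sign of r_k can only be negative for k = n-1, where both signs give
   s(k) = n. *)
have s_mid k : (0 < k < n)%N -> s k = k.+1 :> nat \/ s k = k.+2 :> nat.
  case/andP=> k_gt0 kn.
  suff [skE|skE] : (s k)%:R = k.+1%:R :> R \/ (s k)%:R = k.+2%:R :> R.
  - by left; apply/eqP; rewrite -(eqr_nat R) skE.
  - by right; apply/eqP; rewrite -(eqr_nat R) skE.
  have := s_le k; have : k.+1%:R <= n%:R :> R by rewrite ler_nat.
  have := stepE k; rewrite /mu_coord /rho_k_coord kn (gtn_eqF k_gt0).
  rewrite -?[k.+2%:R]natr1 -?[k.+1%:R]natr1; case: (rE k) => ->; rewrite /rho_g_coord => -[] ? ? ?;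
    solve [left; lra | right; lra].
have s_succ m : forall k, (k + m = n.-1)%N -> (0 < k)%N -> s k = k.+1 :> nat.
  elim: m => [|m IH] k km k_gt0.
    have : (s k < n.+1)%N := ltn_ord _.
    by case: (s_mid k); lia.
  have k1_lt : (k.+1 < n.+1)%N by lia.
  have := IH (Ordinal k1_lt); rewrite /= => /(_ ltac:(lia) isT) sk1.
  case: (s_mid k) => //; first lia.
  rewrite -sk1 => /val_inj/perm_inj/(congr1 val) /=; lia.
have s_ends k : k = 0 :> nat \/ k = n :> nat -> (s k <= 1)%N.
  move=> kE; rewrite leqNgt; apply/negP => sk.
  have p_lt : ((s k).-1 < n.+1)%N by have := ltn_ord (s k); lia.
  have := s_succ (n.-1 - (s k).-1)%N (Ordinal p_lt) => /=.
  have := ltn_ord (s k) => sk' /(_ ltac:(lia) ltac:(lia)) sp.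
  have /val_inj/perm_inj/(congr1 val) /= : s (Ordinal p_lt) = s k :> nat by lia.
  lia.
have s_sum : (s ord0 + s ord_max = 1)%N.
  have := s_ends ord0 (or_introl erefl); have := s_ends ord_max (or_intror erefl).
  have : s ord0 != s ord_max :> nat.
    by apply/negP => /eqP/val_inj/perm_inj/(congr1 val) /=; lia.
  lia.
have s_sumR : (s ord0)%:R + (s ord_max)%:R = 1 :> R by rewrite -natrD s_sum.
have t_ge0 := ler0n R t.
have s0_ge0 := ler0n R (s ord0); have sn_ge0 := ler0n R (s ord_max).
have step0 := stepE ord0; have stepn := stepE ord_max.
rewrite /mu_coord /rho_k_coord /= (_ : (0 < n)%N) in step0; last lia.
rewrite /mu_coord /rho_k_coord /= ltnn (_ : (n == 0)%N = false) in stepn; last lia.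
have r0E : r ord0 = rho_g_coord R (s ord0).
  case: (rE ord0) => //; rewrite /rho_g_coord => ?; exfalso; lra.
have rnE : r ord_max = rho_g_coord R (s ord_max).
  case: (rE ord_max) => //; rewrite /rho_g_coord => ?; exfalso; lra.
(* Adding the equations for the two ends gives 2 t - 2 = -1, 0 or 1, so t = 1 by
   parity. *)
have t1 : t = 1%N.
  have : [\/ (2 * t)%:R = 1%:R :> R, (2 * t)%:R = 2%:R :> R | (2 * t)%:R = 3%:R :> R].
    move: step0 stepn; rewrite r0E rnE /rho_g_coord natrM => -[] ? [] ?;
    solve [constructor 1; lra | constructor 2; lra | constructor 3; lra].
  by case=> /eqP; rewrite eqr_nat => /eqP; lia.
split=> //.
have pred_lt : (n.-1 < n.+1)%N by lia.
pose m : 'I_n.+1 := Ordinal pred_lt.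
exists (2 * r m).
  have := stepE m; rewrite /mu_coord /rho_k_coord /= (_ : (n.-1 < n)%N); last lia.
  rewrite (_ : (n.-1 == 0)%N = false); last lia.
  rewrite natr_pred; last lia.
  by case=> ->; [right|left]; lra.
have r_mid k : (0 < k < n.-1)%N -> r k = n%:R - 2^-1 - k%:R.
  move=> kn; have := s_succ (n.-1 - k)%N k => /(_ ltac:(lia) ltac:(lia)) sk.
  have := stepE k; have := rE k; rewrite /rho_g_coord sk -[k.+1%:R]natr1.
  have : k.+2%:R <= n%:R :> R by rewrite ler_nat; lia.
  rewrite /mu_coord /rho_k_coord (_ : (k < n)%N); last lia.
  rewrite (_ : (k == 0 :> nat) = false); last lia.
  by rewrite -[k.+2%:R]natr1 -[k.+1%:R]natr1 => ? [->|->] // [] ?; lra.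
have r_m k : k = n.-1 :> nat -> r k = 2 * r m / 2.
  by move=> kE; rewrite (_ : k = m); [field|exact: val_inj].
have r_0 k : k = 0%N :> nat -> r k = n%:R + 2^-1 - (s ord0)%:R.
  by move=> kE; rewrite (_ : k = ord0) ?r0E //; exact: val_inj.
have r_n k : k = n :> nat -> r k = n%:R + 2^-1 - (1 - (s ord0)%:R).
  move=> kE; rewrite (_ : k = ord_max) ?rnE; last exact: val_inj.
  by rewrite /rho_g_coord; lra.
have := s_ends ord0 (or_introl erefl).
rewrite leq_eqVlt ltnS leqn0 => /orP[] /eqP s0; rewrite s0 in r_0 r_n; [left|right] => k.
- rewrite /rho1_coord; case: (ord_cases k) => kE.
  + rewrite kE; have [k0|k_gt0] := posnP k; last by rewrite r_mid // k_gt0.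
    by rewrite r_0 // k0; lra.
  + by rewrite kE ltnn eqxx r_m.
  + rewrite r_n // kE (_ : (n < n.-1)%N = false); last lia.
    by rewrite (_ : (n == n.-1) = false); [lra|lia].
- rewrite /rho2_coord; case: (ord_cases k) => kE.
  + rewrite kE; have [k0|k_gt0] := posnP k; last by rewrite r_mid // k_gt0.
    by rewrite r_0 //; lra.
  + by rewrite kE ltnn eqxx r_m.
  + rewrite r_n // kE (_ : (n < n.-1)%N = false); last lia.
    by rewrite (_ : (n == n.-1) = false); [lra|lia].
Qed.

(** * The weights rho and the matching of signs *)

Lemma R_K_perm (r : 'I_n.+1 -> R) (f : nat -> nat) :
  (forall a b, (a <= n)%N -> (b <= n)%N -> f a = f b -> a = b) ->
  (forall a, (a <= n)%N -> (f a <= n)%N) ->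
  (forall k, r k ^+ 2 = (n%:R + 2^-1 - (f k)%:R) ^+ 2) ->
  (forall i j, (i < j < n)%N -> `|r j| <= r i) -> 0 <= r ord_max -> R_K (realw r).
Proof.
move=> f_inj f_le rsq rdom r_last; split; last exact/K_dominant_realP.
rewrite rho_gE; apply/real_weight_orbitP; exists r; split=> //.
have g_inj : injective (fun k => inord (f k) : 'I_n.+1).
  move=> i j /(congr1 val) /=; rewrite !inordK ?ltnS ?f_le ?leq_ord // => fij.
  by apply/val_inj/f_inj; rewrite ?leq_ord.
exists (perm g_inj) => k.
by rewrite rsq /rho_g_coord permE inordK // ltnS f_le ?leq_ord.
Qed.

Lemma R_K_rho1 e : e = 1 \/ e = -1 -> R_K (rho1 n e%:C).
Proof.
move=> e1; rewrite rho1E.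
apply: (@R_K_perm _ (fun a => if a == n then 0%N else a.+1)).
- by move=> a b an bn; do ?[case: eqP => ?]; lia.
- by move=> a an; case: eqP; lia.
- move=> k; rewrite /rho1_coord; case: (ord_cases k) => kE.
  + rewrite kE (_ : (k == n :> nat) = false); last lia.
    by rewrite -[k.+1%:R]natr1; congr (_ ^+ 2); lra.
  + rewrite kE ltnn eqxx (_ : (n.-1 == n) = false); last lia.
    rewrite -[n.-1.+1%:R]natr1 natr_pred; last lia.
    by case: e1 => ->; field.
  + rewrite kE eqxx (_ : (n < n.-1)%N = false); last lia.
    by rewrite (_ : (n == n.-1) = false) ?subr0 //; lia.
- move=> i j ij; rewrite /rho1_coord (_ : (i < n.-1)%N); last lia.
  have : i.+1%:R <= n.-1%:R :> R by rewrite ler_nat; lia.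
  rewrite -[i.+1%:R]natr1 natr_pred; last lia.
  case: (ord_cases j) => jE; last lia.
    have : j.+1%:R <= n.-1%:R :> R by rewrite ler_nat.
    have : i.+1%:R <= j%:R :> R by rewrite ler_nat; lia.
    rewrite jE -[i.+1%:R]natr1 -[j.+1%:R]natr1 natr_pred; last lia.
    by rewrite ler_norml; lra.
  by rewrite jE ltnn eqxx ler_norml; lra.
- rewrite /rho1_coord /= (_ : (n < n.-1)%N = false); last lia.
  rewrite (_ : (n == n.-1) = false); last lia.
  by have := ler0n R n; lra.
Qed.

Lemma R_K_rho2 e : e = 1 \/ e = -1 -> R_K (rho2 n e%:C).
Proof.
move=> e1; rewrite rho2E.
apply: (@R_K_perm _ (fun a => if a == 0 then 0%N else if a == n then 1%N else a.+1)).
- by move=> a b an bn; do ?[case: eqP => ?]; lia.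
- by move=> a an; do ?[case: eqP => ?]; lia.
- move=> k; rewrite /rho2_coord; case: (ord_cases k) => kE.
  + rewrite kE (_ : (k == n :> nat) = false); last lia.
    case: eqP => _; first by rewrite subr0.
    by rewrite -[k.+1%:R]natr1; congr (_ ^+ 2); lra.
  + rewrite kE ltnn eqxx (_ : (n.-1 == n) = false); last lia.
    rewrite (_ : (n.-1 == 0)%N = false); last lia.
    rewrite -[n.-1.+1%:R]natr1 natr_pred; last lia.
    by case: e1 => ->; field.
  + rewrite kE eqxx (_ : (n < n.-1)%N = false); last lia.
    rewrite (_ : (n == n.-1) = false); last lia.
    rewrite (_ : (n == 0)%N = false); last lia.
    by congr (_ ^+ 2); lra.
- move=> i j ij; rewrite /rho2_coord (_ : (i < n.-1)%N); last lia.
  have : i.+1%:R <= n.-1%:R :> R by rewrite ler_nat; lia.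
  rewrite -[i.+1%:R]natr1 natr_pred; last lia.
  rewrite (_ : (j == 0 :> nat) = false); last lia.
  have i0 := ler0n R i.
  case: (ord_cases j) => jE; last lia.
    have : j.+1%:R <= n.-1%:R :> R by rewrite ler_nat.
    have : i.+1%:R <= j%:R :> R by rewrite ler_nat; lia.
    rewrite jE -[i.+1%:R]natr1 -[j.+1%:R]natr1 natr_pred; last lia.
    by rewrite ler_norml; case: eqP => [->|_]; lra.
  by rewrite jE ltnn eqxx ler_norml; case: eqP => [->|_]; lra.
- rewrite /rho2_coord /= (_ : (n < n.-1)%N = false); last lia.
  rewrite (_ : (n == n.-1) = false); last lia.
  by have : 2 <= n%:R :> R; [rewrite (ler_nat R 2)|lra].
Qed.

Lemma Lambda_K_lambda_last e : e = 1 \/ e = -1 ->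
  Lambda_K (lambda0 R n) (lambda_last n e%:C).
Proof.
move=> e1; rewrite lambda_lastE lambda0E; split.
  apply/real_weight_orbitP; exists (lambda_last_coord e); split=> //.
  exists 1%g => k; rewrite perm1 /lambda_last_coord /lambda0_coord.
  case: (ord_cases k) => kE.
  - by rewrite kE (_ : (k < n)%N) //; lia.
  - rewrite kE ltnn eqxx (_ : (n.-1 < n)%N); last lia.
    rewrite natr_pred; last lia.
    by case: e1 => ->; field.
  - rewrite kE ltnn (_ : (n < n.-1)%N = false); last lia.
    by rewrite (_ : (n == n.-1) = false) //; lia.
apply/K_dominant_realP; split=> [i j ij|]; last first.
  rewrite /lambda_last_coord /= (_ : (n < n.-1)%N = false); last lia.
  by rewrite (_ : (n == n.-1) = false); [lra|lia].
rewrite /lambda_last_coord (_ : (i < n.-1)%N); last lia.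
have : i.+1%:R <= n.-1%:R :> R by rewrite ler_nat; lia.
rewrite -[i.+1%:R]natr1 natr_pred; last lia.
case: (ord_cases j) => jE; last lia.
  have : j.+1%:R <= n.-1%:R :> R by rewrite ler_nat.
  have : i.+1%:R <= j%:R :> R by rewrite ler_nat; lia.
  rewrite jE -[i.+1%:R]natr1 -[j.+1%:R]natr1 natr_pred; last lia.
  by rewrite ler_norml; lra.
by rewrite jE ltnn eqxx ler_norml; lra.
Qed.

(** The first n coordinates met below are a constant c corrected by factors b
    at the first and e at the n-th position. The two corrections are kept
    apart because for n = 2 these positions are adjacent but distinct. *)
Lemma prod_D_coords (z : 'I_n.+1 -> R) c b e :
  (forall k, (k < n)%N -> z k = c * (if k == 0 :> nat then b else 1)
     * (if k == n.-1 :> nat then e else 1)) ->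
  \prod_(k < n.+1 | (k < n)%N) z k = c ^+ n * b * e.
Proof.
have prod1 m x : (m < n)%N ->
    \prod_(k < n) (if k == m :> nat then x else 1) = x :> R.
  move=> mn; rewrite (bigD1 (Ordinal mn)) //= eqxx big1 ?mulr1 // => k.
  by rewrite -val_eqE /= => /negbTE ->.
move=> zE; rewrite (eq_bigr _ zE) (big_ord_narrow (leqnSn n)) /=.
rewrite 2!big_split /= prodr_const card_ord.
by rewrite (prod1 0%N) ?(prod1 n.-1) //; lia.
Qed.

(** For weights with all coordinates 1/2 or -1/2 the product of the first n
    coordinates is a complete invariant of W(k)-orbits. *)
Lemma K_dominant_rep_halfP (z : 'I_n.+1 -> R) a b e d :
  (forall k, z k ^+ 2 = 2^-1 ^+ 2) ->
  (forall k, (k < n)%N -> z k = 2^-1 * a * (if k == 0 :> nat then b else 1)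
     * (if k == n.-1 :> nat then e else 1)) ->
  d = 1 \/ d = -1 ->
  K_dominant_rep (realw z) (realw (half_coord d)) <-> d = a ^+ n * b * e.
Proof.
move=> zsq zE d1.
have half_prod : \prod_(k < n.+1 | (k < n)%N) half_coord d k = 2^-1 ^+ n * d.
  rewrite (@prod_D_coords _ 2^-1 1 d) ?mulr1 // => k kn.
  rewrite /half_coord if_same mulr1.
  by case: eqP => _; rewrite ?mulr1 // mulrC.
have z_prod := prod_D_coords zE.
have pow_neq0 : 2^-1 ^+ n != 0 :> R by rewrite expf_neq0 ?invr_eq0 ?pnatr_eq0.
split=> [[/weyl_orbit_k_Dprod]|dE].
  rewrite !Dprod_real_weight half_prod z_prod exprMn -!mulrA => /complexI.
  by move/(mulfI pow_neq0).
split; last first.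
  by apply: K_dominant_half; case: d1 => ->; rewrite ?normrN normr1.
have prods : Dprod (realw (half_coord d)) = Dprod (realw z).
  by rewrite !Dprod_real_weight half_prod z_prod {1}dE exprMn !mulrA.
apply: weyl_orbit_k_sign => // [k|].
  rewrite !mxE -!rmorphXn zsq /half_coord.
  by case: ifP => _ //; case: d1 => ->; rewrite /= ?mulN1r ?mul1r ?sqrrN.
rewrite -prods Dprod_real_weight half_prod fmorph_eq0 mulf_neq0 //.
by case: d1 => ->; rewrite ?oppr_eq0 oner_eq0.
Qed.

(** The first n coordinates of mu_1 - rho1 e + rho_k are
    1/2, -1/2, ..., -1/2, -e/2, whence the sign (-1)^(n-1) e. *)
Lemma K_dominant_rep_rho1 e d : e = 1 \/ e = -1 -> d = 1 \/ d = -1 ->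
  K_dominant_rep (mu_ R n 1 - rho1 n e%:C + rho_k R n)
    (lambda_last n d%:C - rho_k R n) <-> d = (-1) ^+ n.+1 * e.
Proof.
move=> e1 d1; rewrite mu_E ?(ltnW n_ge2) // rho1E lambda_last_sub_rho_k rho_kE.
rewrite real_weightB real_weightD exprSr.
have n0 : (n == 0)%N = false by lia.
have nn : (n == n.-1) = false by lia.
have nn' : (n < n.-1)%N = false by lia.
have pn : (n.-1 < n)%N by lia.
have p0 : (n.-1 == 0)%N = false by lia.
have n1 := natr_pred (ltnW n_ge2).
apply: K_dominant_rep_halfP => // k;
  rewrite /mu_coord /rho1_coord /rho_k_coord; case: (ord_cases k) => kE.
- rewrite kE (_ : (k < n)%N) //; last lia.
  by case: eqP => [->|_]; [congr (_ ^+ 2); lra|rewrite -sqrrN; congr (_ ^+ 2); lra].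
- rewrite kE ltnn eqxx pn p0 n1.
  by case: e1 => ->; field.
- by rewrite kE ltnn n0 nn nn'; field.
- move=> kn; rewrite kE kn (_ : (k == n.-1 :> nat) = false); last lia.
  by case: eqP => [->|_]; lra.
- by rewrite kE ltnn eqxx pn p0 n1 => _; lra.
- by rewrite kE ltnn.
Qed.

(** The first n coordinates of mu_1 - rho2 e + rho_k are
    -1/2, ..., -1/2, -e/2, whence the sign (-1)^n e. *)
Lemma K_dominant_rep_rho2 e d : e = 1 \/ e = -1 -> d = 1 \/ d = -1 ->
  K_dominant_rep (mu_ R n 1 - rho2 n e%:C + rho_k R n)
    (lambda_last n d%:C - rho_k R n) <-> d = (-1) ^+ n * e.
Proof.
move=> e1 d1; rewrite mu_E ?(ltnW n_ge2) // rho2E lambda_last_sub_rho_k rho_kE.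
rewrite real_weightB real_weightD -[(-1) ^+ n]mulr1.
have n0 : (n == 0)%N = false by lia.
have nn : (n == n.-1) = false by lia.
have nn' : (n < n.-1)%N = false by lia.
have pn : (n.-1 < n)%N by lia.
have p0 : (n.-1 == 0)%N = false by lia.
have n1 := natr_pred (ltnW n_ge2).
apply: K_dominant_rep_halfP => // k;
  rewrite /mu_coord /rho2_coord /rho_k_coord; case: (ord_cases k) => kE.
- rewrite kE (_ : (k < n)%N) //; last lia.
  by rewrite -sqrrN; congr (_ ^+ 2); case: eqP => [->|_]; lra.
- rewrite kE ltnn eqxx pn p0 n1.
  by case: e1 => ->; field.
- by rewrite kE ltnn n0 nn nn'; field.
- move=> kn; rewrite kE kn (_ : (k == n.-1 :> nat) = false); last lia.
  by case: eqP => [->|_]; lra.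
- by rewrite kE ltnn eqxx pn p0 n1 => _; lra.
- by rewrite kE ltnn.
Qed.

(** The parity of n enters only through the sign relating lambda to rho. *)
Lemma dirac_tripleP (V : gmodule R n) (mu rho lam : weight R n) :
  (forall mu : weight R n, K_type V mu <-> exists s : nat, mu = mu_ R n s) ->
  dirac_triple V (lambda0 R n) mu rho lam <->
  exists2 e : R, e = 1 \/ e = -1 &
    (mu, rho, lam) = (mu_ R n 1, rho1 n e%:C, lambda_last n ((-1) ^+ n.+1 * e)%:C) \/
    (mu, rho, lam) = (mu_ R n 1, rho2 n e%:C, lambda_last n ((-1) ^+ n * e)%:C).
Proof.
move=> Ktypes; have signM m e : e = 1 \/ e = -1 ->
    (-1) ^+ m * e = 1 \/ (-1) ^+ m * e = -1.
  by rewrite -signr_odd; case: (odd m) => -[] ->;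
     rewrite ?expr1 ?expr0 ?mulr1 ?mulrN1 ?opprK; auto.
split; last first.
  case=> e e1 [] [-> -> ->].
    split; [exact: R_K_rho1|exact/Lambda_K_lambda_last/signM|by apply/Ktypes; exists 1%N|].
    by apply/K_dominant_rep_rho1 => //; exact: signM.
  split; [exact: R_K_rho2|exact/Lambda_K_lambda_last/signM|by apply/Ktypes; exists 1%N|].
  by apply/K_dominant_rep_rho2 => //; exact: signM.
case=> -[rho_orb _] lamK /Ktypes[t ->] rep.
have [d d1 lamE] := Lambda_K_last_coord lamK (proj2 rep).
move: rep; rewrite {}lamE {lamK}.
move: rho_orb; rewrite rho_gE => /real_weight_orbitP[r [rhoE [s rsq]]].
move=> rep.
have [t1 [e e1 rE]] : t = 1%N /\
    exists2 e : R, e = 1 \/ e = -1 & r =1 rho1_coord e \/ r =1 rho2_coord e.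
  (* The condition that all coordinates square to 1/4 is W(g)-invariant, hence
     W(k)-invariant. *)
  apply: (rho_coord_cases rsq) => k.
  case: rep => /weyl_orbit_kg/weyl_orbit_gP[p] + _.
  rewrite rhoE lambda_last_sub_rho_k mu_E ?(ltnW n_ge2) // rho_kE.
  rewrite real_weightB real_weightD => /(_ (p^-1 k)%g).
  rewrite permKV !mxE -!rmorphXn => /complexI <-; rewrite /half_coord.
  by case: ifP => _ //; case: d1 => ->; rewrite ?mulN1r ?mul1r ?sqrrN.
move: rep; rewrite t1 => rep.
exists e => //; case: rE => /eq_real_weight rE; move: rhoE; rewrite rE => rhoE.
  rewrite -rho1E in rhoE; rewrite rhoE in rep *; left.
  by move/K_dominant_rep_rho1: rep => <-.
rewrite -rho2E in rhoE; rewrite rhoE in rep *; right.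
by move/K_dominant_rep_rho2: rep => <-.
Qed.

End Triples.

Theorem proposition5p1 (R : realType) (n : nat) (hn : (2 <= n)%N)
  (V : gmodule R n)
  (hgK : gK_module V) (hirr : irreducible V)
  (hann : joseph_ideal (annihilator V))
  (hinf : infinitesimal_character V (lambda0 R n))
  (hK : forall mu : weight R n, K_type V mu <-> exists s : nat, mu = mu_ R n s)
  (hmult : forall s : nat, K_type_multiplicity_one V (mu_ R n s)) :
  (~~ odd n -> forall mu rho lam : weight R n,
     dirac_triple V (lambda0 R n) mu rho lam <->
     (mu, rho, lam) \in
       [:: (mu_ R n 1, rho1 n 1, lambda_last n (-1));
           (mu_ R n 1, rho1 n (-1), lambda_last n 1);
           (mu_ R n 1, rho2 n 1, lambda_last n 1);
           (mu_ R n 1, rho2 n (-1), lambda_last n (-1))]) /\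
  (odd n -> forall mu rho lam : weight R n,
     dirac_triple V (lambda0 R n) mu rho lam <->
     (mu, rho, lam) \in
       [:: (mu_ R n 1, rho1 n 1, lambda_last n 1);
           (mu_ R n 1, rho1 n (-1), lambda_last n (-1));
           (mu_ R n 1, rho2 n 1, lambda_last n (-1));
           (mu_ R n 1, rho2 n (-1), lambda_last n 1)]).
Proof.
have C1 : (1 : R)%:C = 1 by [].
have CN1 : (- 1 : R)%:C = -1 by rewrite rmorphN1.
have two (P : R -> Prop) : (exists2 e : R, e = 1 \/ e = -1 & P e) <-> P 1 \/ P (-1).
  by split=> [[e [] ->]|[]]; [left|right|exists 1; auto|exists (-1); auto].
split=> n_par mu rho lam; rewrite (dirac_tripleP hn _ _ _ hK) two.
  rewrite -!(signr_odd _ n.+1) -!(signr_odd _ n) /= (negbTE n_par).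
  rewrite !expr0 !expr1 !mul1r !mulN1r opprK !C1 !CN1 !inE.
  split=> [[[]|[]] ->|/or4P[] /eqP->]; rewrite ?eqxx ?orbT //; tauto.
rewrite -!(signr_odd _ n.+1) -!(signr_odd _ n) /= n_par.
rewrite !expr0 !expr1 !mul1r !mulN1r opprK !C1 !CN1 !inE.
by split=> [[[]|[]] ->|/or4P[] /eqP->]; rewrite ?eqxx ?orbT //; tauto.
Qed.
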